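(* Let $A=\begin{bmatrix} a & b\\ c& d\end{bmatrix}$ be a $2\times 2$ matrix with entries in the quaternions $\mathbb{H}$, with $b\neq 0$. Let $\mu\colon\mathbb{H}\to\mathbb{H}$ be the map $\mu(\lambda)=c-(d-\lambda)b^{-1}(a-\lambda)$, and let $\lambda\in\mathbb{H}$ be a left eigenvalue of $A$. If the differential $\mu_{*\lambda}$ has rank $2$, then one of the following holds: (1) the left spectrum $\sigma_l(A)$ is spherical, and $\mu_{*\lambda'}$ has rank $2$ for every left eigenvalue $\lambda'$ of $A$; or (2) $A$ has just one left eigenvalue.
   Context: $\mathbb{H}$ denotes the quaternions, identified as a manifold with $\mathbb{R}^4$. A quaternion $\lambda$ is a left eigenvalue of a square quaternionic matrix $A$ if $A-\lambda\,\mathrm{Id}$ is not invertible; $\sigma_l(A)$ is the set of left eigenvalues. For $b\ne 0$, the left eigenvalues of the $2\times2$ quaternionic matrix $A=\begin{bmatrix} a & b\\ c& d\end{bmatrix}$ are exactly the zeros of the map $\mu(\lambda)=c-(d-\lambda)b^{-1}(a-\lambda)$. The differential of $\mu$ at $\lambda$ is the $\mathbb{R}$-linear map $\mu_{*\lambda}\colon\mathbb{H}\to\mathbb{H}$, $\mu_{*\lambda}(X)=Xb^{-1}(a-\lambda)+(d-\lambda)b^{-1}X$; its rank is its rank as a real linear map. Put $a_0=-b^{-1}c$, $a_1=b^{-1}(a-d)$, $\Delta=a_1^2-4a_0$. The spectrum is called spherical when it is infinite; by a theorem of Huang and So this is equivalent to: $a_0,a_1$ are real, $a_0\neq 0$ and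 $\Delta<0$; in that case $\sigma_l(A)=\{\tfrac12(a+d+bq)\colon q\in\mathbb{H},\ q^2=\Delta\}$, which is diffeomorphic to the sphere $S^2$. *)

(* Defs.v *)
From HB Require Import structures.
From mathcomp Require Import all_boot all_order all_algebra.
From mathcomp Require Import all_classical all_reals all_analysis.
From mathcomp Require Import ring lra.
Set Implicit Arguments. Unset Strict Implicit. Unset Printing Implicit Defensive.
Import Order.TTheory GRing.Theory Num.Theory.
Import numFieldNormedType.Exports.
Local Open Scope classical_set_scope.
Local Open Scope ring_scope.

(* The quaternion x0 + x1 i + x2 j + x3 k is the row vector (x0, x1, x2, x3).
   The vector space structure and the topology are those of R^4; the norm `|x|
   inherited from 'rV[R]_4 is the sup norm, NOT the quaternionic norm, which
   makes no difference for differentials. *)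
Definition quat (R : realType) : Type := 'rV[R]_4.

HB.instance Definition _ (R : realType) := NormedModule.copy (quat R) 'rV[R]_4.
HB.instance Definition _ (R : realType) := Vector.copy (quat R) 'rV[R]_4.

Section QuaternionRing.
Variable R : realType.
Implicit Types x y z : quat R.

Definition mkquat (x0 x1 x2 x3 : R) : quat R :=
  \row_(i < 4) [:: x0; x1; x2; x3]`_i.

(* For n < 4 only: inord sends every n >= 4 to 0. *)
Definition qc (n : nat) x : R := x ord0 (inord n).

Lemma qcE n (x0 x1 x2 x3 : R) : (n < 4)%N ->
  qc n (mkquat x0 x1 x2 x3) = [:: x0; x1; x2; x3]`_n.
Proof. by move=> n4; rewrite /qc mxE inordK. Qed.

Lemma quatP x y : [/\ qc 0 x = qc 0 y, qc 1 x = qc 1 y, qc 2 x = qc 2 y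
  & qc 3 x = qc 3 y] -> x = y.
Proof.
move=> [e0 e1 e2 e3]; apply/rowP => i.
rewrite -(inord_val i).
by case: i => [[|[|[|[|]]]] //= _].
Qed.

Lemma qcD n x y : qc n (x + y) = qc n x + qc n y. Proof. exact: mxE. Qed.
Lemma qc0 n : qc n 0 = 0. Proof. exact: mxE. Qed.

(* Hamilton's product: i^2 = j^2 = k^2 = ijk = -1. *)
Definition qmul x y : quat R := mkquat
  (qc 0 x * qc 0 y - qc 1 x * qc 1 y - qc 2 x * qc 2 y - qc 3 x * qc 3 y)
  (qc 0 x * qc 1 y + qc 1 x * qc 0 y + qc 2 x * qc 3 y - qc 3 x * qc 2 y)
  (qc 0 x * qc 2 y - qc 1 x * qc 3 y + qc 2 x * qc 0 y + qc 3 x * qc 1 y)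
  (qc 0 x * qc 3 y + qc 1 x * qc 2 y - qc 2 x * qc 1 y + qc 3 x * qc 0 y).

Definition qone : quat R := mkquat 1 0 0 0.

Lemma qmulA : associative qmul.
Proof. by move=> x y z; apply/quatP; split; rewrite !qcE //=; ring. Qed.
Lemma qmul1l : left_id qone qmul.
Proof. by move=> x; apply/quatP; split; rewrite !qcE //=; ring. Qed.
Lemma qmul1r : right_id qone qmul.
Proof. by move=> x; apply/quatP; split; rewrite !qcE //=; ring. Qed.
Lemma qmulDl : left_distributive qmul +%R.
Proof. by move=> x y z; apply/quatP; split; rewrite !(qcD, qcE) //=; ring. Qed.
Lemma qmulDr : right_distributive qmul +%R.
Proof. by move=> x y z; apply/quatP; split; rewrite !(qcD, qcE) //=; ring. Qed.
Lemma qone_neq0 : qone != 0.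
Proof.
by apply/eqP => /(congr1 (qc 0)); rewrite qcE // qc0 /=; apply/eqP/oner_neq0.
Qed.

HB.instance Definition _ := GRing.Zmodule_isNzRing.Build (quat R)
  qmulA qmul1l qmul1r qmulDl qmulDr qone_neq0.

Lemma qscaleAl (k : R) x y : k *: (x * y) = (k *: x) * y.
Proof.
have Z n z : qc n (k *: z) = k * qc n z by rewrite /qc mxE.
by apply/quatP; split; rewrite Z !qcE // !Z /=; ring.
Qed.
Lemma qscaleAr (k : R) x y : k *: (x * y) = x * (k *: y).
Proof.
have Z n z : qc n (k *: z) = k * qc n z by rewrite /qc mxE.
by apply/quatP; split; rewrite Z !qcE // !Z /=; ring.
Qed.

HB.instance Definition _ := GRing.Lmodule_isLalgebra.Build R (quat R) qscaleAl.
HB.instance Definition _ := GRing.Lalgebra_isAlgebra.Build R (quat R) qscaleAr.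

Definition qnormsq x : R := qc 0 x ^+ 2 + qc 1 x ^+ 2 + qc 2 x ^+ 2 + qc 3 x ^+ 2.

(* x^-1 = conj(x) / |x|^2; in particular 0^-1 = 0 *)
Definition qinv x : quat R := mkquat (qc 0 x / qnormsq x)
  (- qc 1 x / qnormsq x) (- qc 2 x / qnormsq x) (- qc 3 x / qnormsq x).

Lemma qnormsq_eq0 x : (qnormsq x == 0) = (x == 0).
Proof.
apply/eqP/eqP => [|->]; last by rewrite /qnormsq !qc0; ring.
rewrite /qnormsq => h.
have := sqr_ge0 (qc 0 x); have := sqr_ge0 (qc 1 x).
have := sqr_ge0 (qc 2 x); have := sqr_ge0 (qc 3 x) => h3 h2 h1 h0.
by apply/quatP; split; rewrite qc0; apply/eqP; rewrite -sqrf_eq0; apply/eqP; lra.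
Qed.

Definition qunit : {pred quat R} := [pred x | x != 0].

Lemma qmulVr : {in qunit, left_inverse 1 qinv *%R}.
Proof.
move=> x; rewrite inE -qnormsq_eq0 => x0.
by apply/quatP; split; rewrite !qcE //=; move: x0; rewrite /qnormsq => x0; field.
Qed.

Lemma qdivrr : {in qunit, right_inverse 1 qinv *%R}.
Proof.
move=> x; rewrite inE -qnormsq_eq0 => x0.
by apply/quatP; split; rewrite !qcE //=; move: x0; rewrite /qnormsq => x0; field.
Qed.

Lemma qunitP x y : y * x = 1 /\ x * y = 1 -> qunit x.
Proof.
case=> yx _; apply/eqP => x0; move: yx; rewrite x0 mulr0 => /esym/eqP.
by rewrite oner_eq0.
Qed.

Lemma qinv_out : {in [predC qunit], qinv =1 id}.
Proof.
move=> x; rewrite !inE negbK => /eqP ->.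
by apply/quatP; split; rewrite !qcE //= qc0 ?oppr0 mul0r.
Qed.

HB.instance Definition _ := GRing.NzRing_hasMulInverse.Build (quat R)
  qmulVr qdivrr qunitP qinv_out.

End QuaternionRing.

Section LeftSpectrum.
Variable R : realType.

(* unitmx and invmx are only available over commutative rings. *)
Definition invertible_mx n (A : 'M[quat R]_n) : Prop :=
  exists B : 'M[quat R]_n, A *m B = 1%:M /\ B *m A = 1%:M.

Definition left_spectrum n (A : 'M[quat R]_n) : set (quat R) :=
  [set l | ~ invertible_mx (A - l%:M)].

Definition spherical n (A : 'M[quat R]_n) : Prop := infinite_set (left_spectrum A).

Definition mx22 (a b c d : quat R) : 'M[quat R]_2 :=
  \matrix_(i < 2, j < 2)
    if i == 0 then (if j == 0 then a else b) else (if j == 0 then c else d).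

Definition mu (a b c d l : quat R) : quat R := c - (d - l) * b^-1 * (a - l).

(* 'd f l is the Frechet differential of f over R at l. *)
Definition rank_diff (f : quat R -> quat R) (l : quat R) : nat :=
  \dim (limg (linfun ('d f l))).

End LeftSpectrum.

(* Main.v *)
Require Import Defs.
From HB Require Import structures.
From mathcomp Require Import all_boot all_order all_algebra.
From mathcomp Require Import all_classical all_reals all_analysis.
From mathcomp Require Import ring lra.
Import GRing.Theory Num.Theory.
Import Order.TTheory numFieldNormedType.Exports.
Local Open Scope classical_set_scope.
Local Open Scope ring_scope.

(** Put x = b^-1 (a - l) and p = - (d - l) b^-1. Translating mu by t gives
      mu (l + t) = mu l + (t x - p t) - t b^-1 t,
    so the differential of mu at l is the Sylvester operator
    S p x : X |-> X x - p X. When mu l = 0 and t <> 0, multiplying by t^-1 on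
    both sides shows that l + t is another zero exactly when w = t^-1 solves the
    linear equation S x p w = - b^-1, in which p and x are exchanged.

    If the differential has rank 2, it kills some Y <> 0, so x and p are similar
    and share their real part. Conjugation then maps solutions of Y x = p Y to
    solutions of x V = V p, hence exchanges the kernels of S p x and S x p. So
    the linear equation has a homogeneous solution V <> 0, and the existence of a
    second zero l + t makes a whole line t^-1 + k V of solutions, i.e. an
    infinite spectrum. If there is no second zero, l is the only left eigenvalue.

    As to the rank at another zero l + t: there x and p become x - b^-1 t and
    p + t b^-1, which are t^-1 p t and t x t^-1 because l + t is a zero.
    So the new Sylvester operator is S x p up to the substitution
    X |-> t^-1 X t^-1, and S x p has the same rank as S p x by conjugation. *)

(** * Quaternion conjugation *)

Section QuaternionConjugation.
Context {R : realType}.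
Implicit Types (k : R) (x y p : quat R).

Lemma qcZ n k x : qc n (k *: x) = k * qc n x.
Proof. exact: mxE. Qed.

Lemma qcN n x : qc n (- x) = - qc n x.
Proof. exact: mxE. Qed.

Lemma qc1E n : (n < 4)%N -> qc n (1 : quat R) = (n == 0)%:R.
Proof. by case: n => [|[|[|[|]]]] // _; rewrite [1]/(qone R) qcE. Qed.

Lemma qcM x y :
  (qc 0 (x * y) = qc 0 x * qc 0 y - qc 1 x * qc 1 y - qc 2 x * qc 2 y - qc 3 x * qc 3 y) *
  (qc 1 (x * y) = qc 0 x * qc 1 y + qc 1 x * qc 0 y + qc 2 x * qc 3 y - qc 3 x * qc 2 y) *
  (qc 2 (x * y) = qc 0 x * qc 2 y - qc 1 x * qc 3 y + qc 2 x * qc 0 y + qc 3 x * qc 1 y) *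
  (qc 3 (x * y) = qc 0 x * qc 3 y + qc 1 x * qc 2 y - qc 2 x * qc 1 y + qc 3 x * qc 0 y).
Proof. by do 3?split; rewrite qcE. Qed.

Definition qconj x : quat R := mkquat (qc 0 x) (- qc 1 x) (- qc 2 x) (- qc 3 x).

Lemma qconj_is_linear : linear qconj.
Proof.
by move=> k x y; apply/quatP; split; rewrite !(qcD, qcZ, qcE) //=; ring.
Qed.
HB.instance Definition _ := GRing.isLinear.Build R (quat R) (quat R) _ qconj
  qconj_is_linear.

Lemma qconjK : involutive qconj.
Proof. by move=> x; apply/quatP; split; rewrite !qcE //= opprK. Qed.

Lemma qconjM x y : qconj (x * y) = qconj y * qconj x.
Proof. by apply/quatP; split; rewrite !(qcE, qcM) //=; ring. Qed.

Lemma qconjE x : qconj x = (qc 0 x *+ 2)%:A - x.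
Proof.
apply/quatP; split; rewrite !qcE // qcD qcN qcZ qc1E //=; ring.
Qed.

Lemma qc0_mulC x y : qc 0 (x * y) = qc 0 (y * x).
Proof. by rewrite !qcM; ring. Qed.

(** The real part is a trace: it is invariant under similarity. *)
Lemma qc0_similar {p x y} : y != 0 -> y * x = p * y -> qc 0 x = qc 0 p.
Proof.
move=> y0 yx; rewrite -[p](mulrK (y0 : y \is a GRing.unit)) -yx.
by rewrite -mulrA qc0_mulC mulrVK.
Qed.

End QuaternionConjugation.

(** * Left eigenvalues as zeros of mu *)

Section LeftEigenvalues.
Context {R : realType}.
Implicit Types (a b c d l t : quat R).

Lemma mx22E a b c d : (mx22 a b c d 0 0 = a) * (mx22 a b c d 0 1 = b) *
  (mx22 a b c d 1 0 = c) * (mx22 a b c d 1 1 = d).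
Proof. by do 3?split; rewrite mxE. Qed.

Lemma mx22P (A B : 'M[quat R]_2) :
  [/\ A 0 0 = B 0 0, A 0 1 = B 0 1, A 1 0 = B 1 0 & A 1 1 = B 1 1] -> A = B.
Proof.
have o2 (i : 'I_2) : i = 0 \/ i = 1.
  by case: i => [[|[|]]] //= i; [left|right]; apply/val_inj.
by case=> *; apply/matrixP => i j; case: (o2 i) => ->; case: (o2 j) => ->.
Qed.

Lemma mulmx22 (A B : 'M[quat R]_2) i j :
  (A *m B) i j = A i 0 * B 0 j + A i 1 * B 1 j.
Proof.
rewrite mxE !big_ord_recl big_ord0 addr0.
by congr (_ + _ * B _ _); [congr (A _ _)|]; apply/val_inj.
Qed.

(** The Schur complement of the invertible entry b in the matrix with rows
    (a - l, b) and (c, d - l) is mu l. When mu l <> 0, elimination over the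
    division ring inverts the matrix; when mu l = 0, the matrix annihilates the
    column (1, - b^-1 (a - l)). *)
Lemma left_spectrumE a b c d l : b != 0 ->
  left_spectrum (mx22 a b c d) l <-> mu a b c d l = 0.
Proof.
move=> b0; have bU : b \is a GRing.unit by [].
rewrite /left_spectrum /mu /=.
have -> : mx22 a b c d - l%:M = mx22 (a - l) b c (d - l).
  apply: mx22P; split; rewrite !mxE /= ?subr0 //.
move: (a - l) (d - l) => {a d l} a d; split => [ninv|m0 [B [_ BA]]].
  apply: contrapT => /eqP m0; apply: ninv.
  have mU : c - d * b^-1 * a \is a GRing.unit by [].
  set m := c - d * b^-1 * a in mU.
  have mE : c = m + d * b^-1 * a by rewrite subrK.
  (* This inverse is found by solving a u + b v = s, c u + d v = t for (u, v). *)
  exists (mx22 (- (m^-1 * (d * b^-1))) m^-1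
    (b^-1 + b^-1 * a * m^-1 * (d * b^-1)) (- (b^-1 * a * m^-1))).
  split; apply: mx22P; split; rewrite mulmx22 !mx22E !mxE /= ?mulr1n ?mulr0n.
  - by rewrite mulrDr divrr // mulrN !mulrA divrr // mul1r addrCA addNr addr0.
  - by rewrite mulrN !mulrA divrr // mul1r subrr.
  - rewrite mE mulrN mulrDl mulrDr !mulrA divrr // mul1r.
    by rewrite opprD addrACA addNr add0r addNr.
  - by rewrite mE mulrN mulrDl divrr // !mulrA addrK.
  - by rewrite mE mulNr mulrDr mulVr // !mulrA addrCA addNr addr0.
  - by rewrite mulNr -!mulrA mulVr // mulr1 addNr.
  - rewrite {1}mE mulrDl mulNr mulrDr -!mulrA mulVr // mulr1.
    by rewrite opprD addrACA subrr add0r subrr.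
  - by rewrite mulrDl mulVr // mulNr -!mulrA mulVr // mulr1 addrK.
(* The first column of N is the annihilated vector. *)
pose N := mx22 1 0 (- (b^-1 * a)) 1.
have : (B *m (mx22 a b c d *m N)) 0 0 = 1.
  by rewrite mulmxA BA mul1mx mx22E.
rewrite mulmx22 !mulmx22 !mx22E !mulr1 !mulrN !mulrA divrr // mul1r subrr.
by rewrite m0 !mulr0 addr0 => /esym/eqP; rewrite oner_eq0.
Qed.

End LeftEigenvalues.

(** * Sylvester operators and the differential of mu *)

Section Differential.
Context {R : realType}.
Implicit Types (a b c d l t p x : quat R).

Definition sylvester p x (X : quat R) : quat R := X * x - p * X.

Lemma sylvester_is_linear p x : linear (sylvester p x).
Proof.
move=> k u v; rewrite /sylvester mulrDl mulrDr -scalerAl -scalerAr scalerBr.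
by rewrite opprD addrACA.
Qed.
HB.instance Definition _ p x := GRing.isLinear.Build R (quat R) (quat R) _
  (sylvester p x) (sylvester_is_linear p x).

(** Since qconj z = 2 Re z - z and x, p have the same real part, conjugating
    y p - x y restores x and p, in exchanged positions. *)
Lemma sylvester_conj p x y : qc 0 x = qc 0 p ->
  sylvester p x (qconj y) = qconj (sylvester x p y).
Proof.
move=> xp; rewrite /sylvester linearB /= !qconjM (qconjE x) (qconjE p) xp.
rewrite mulrBl mulrBr -scalerAl -scalerAr mul1r mulr1.
by rewrite opprB [RHS]addrC addrA subrK.
Qed.

Lemma sylvester_inv p x t : t != 0 ->
  sylvester p x t = - (t * sylvester x p t^-1 * t).
Proof.
move=> t0; have tU : t \is a GRing.unit by [].
rewrite /sylvester mulrBr mulrBl -!mulrA mulVr // !mulrA divrr // mul1r mulr1.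
by rewrite opprB.
Qed.

Lemma mu_shift a b c d l t :
  mu a b c d (l + t) = mu a b c d l
    + sylvester (- ((d - l) * b^-1)) (b^-1 * (a - l)) t - t * b^-1 * t.
Proof.
rewrite /mu /sylvester !opprD !addrA.
move: (a - l) (d - l) => {}a {}d.
rewrite !mulrBl !mulrBr mulNr !opprK !mulrA !opprB.
rewrite -!addrA; congr (c + _); rewrite [RHS]addrC -!addrA; congr (_ + _).
exact: addrCA.
Qed.

Lemma qc_norm_le n x : `|qc n x| <= `|x|.
Proof.
rewrite [leRHS]/Num.Def.normr /= mx_normrE; apply/bigmax_geP; right => /=.
by exists (ord0, inord n).
Qed.

Lemma qnorm_le x (M : R) :
  0 <= M -> (forall n, (n < 4)%N -> `|qc n x| <= M) -> `|x| <= M.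
Proof.
move=> M0 xM; rewrite [leLHS]/Num.Def.normr /= mx_normrE.
apply: bigmax_le => //= -[i j] _ /=.
by rewrite (ord1 i); have := xM j (ltn_ord j); rewrite /qc inord_val.
Qed.

(** The norm is the sup norm, hence the factor 4: each coordinate of a product is
    a sum of four products of coordinates. *)
Lemma qnormM x y : `|x * y| <= 4 * `|x| * `|y|.
Proof.
have M0 : 0 <= `|x| * `|y| by rewrite mulr_ge0.
have qM i j : `|qc i x * qc j y| <= `|x| * `|y|.
  by rewrite normrM ler_pM // qc_norm_le.
have q4 (s t u v : R) M : `|s| <= M -> `|t| <= M -> `|u| <= M -> `|v| <= M ->
    `|s + t + u + v| <= 4 * M.
  move=> sM tM uM vM; apply: le_trans (ler_normD _ _) _.
  have := ler_normD (s + t) u; have := ler_normD s t; lra.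
rewrite -mulrA; apply: qnorm_le => [|[|[|[|[|n]]]] // _].
- by rewrite mulr_ge0.
all: by rewrite qcM; apply: q4; rewrite ?normrN.
Qed.

Lemma diff_quadratic (f : quat R -> quat R) l p x (q : quat R -> quat R) (k : R) :
  (forall t, f (l + t) = f l + sylvester p x t + q t) ->
  (forall t, `|q t| <= k * `|t| ^+ 2) ->
  'd f l = sylvester p x :> (quat R -> quat R).
Proof.
move=> fE qk; apply: diff_unique.
  apply/bounded_linear_continuous/bounded_funP => r.
  exists (4 * (`|x| + `|p|) * r) => t tr.
  apply: le_trans (ler_normB _ _) _.
  have := qnormM t x; have := qnormM p t.
  have := normr_ge0 x; have := normr_ge0 p; nra.
apply/eqaddoP => _/posnumP[e].
have [k0|k0] := leP k 0; near=> t; rewrite /= (_ : _ t = q t);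
  do ?by rewrite /= !fctE /= [X in f X]addrC fE [X in X - _]addrC addrK.
  apply: le_trans (qk t) _; apply: (@le_trans _ _ 0).
    by rewrite mulr_le0_ge0 // exprn_ge0.
  by rewrite mulr_ge0.
apply: le_trans (qk t) _; rewrite expr2 mulrA; apply: ler_wpM2r => //.
rewrite -ler_pdivlMl // ltW //; near: t.
by apply: cvgr0_norm_lt => //; rewrite mulr_gt0 ?invr_gt0.
Unshelve. all: by end_near. Qed.

Lemma diff_mu a b c d l :
  'd (mu a b c d) l
    = sylvester (- ((d - l) * b^-1)) (b^-1 * (a - l)) :> (quat R -> quat R).
Proof.
apply: (diff_quadratic _ _ _ _ (fun t => - (t * b^-1 * t)) (16 * `|b^-1|)) => t.
  exact: mu_shift.
rewrite normrN; have := qnormM (t * b^-1) t; have := qnormM t b^-1.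
have := normr_ge0 t; have := normr_ge0 (b^-1); nra.
Qed.

Lemma rank_diff_mu a b c d l :
  rank_diff (mu a b c d) l
    = \dim (limg (linfun (sylvester (- ((d - l) * b^-1)) (b^-1 * (a - l))))).
Proof.
rewrite /rank_diff; congr (\dim (limg _)).
by apply/lfunP => X; rewrite !lfunE /= diff_mu.
Qed.

End Differential.

(** * Ranks of Sylvester operators *)

Section Rank.
Context {R : realType}.
Implicit Types (p x e t : quat R).

(** By the rank-nullity theorem, comparing kernels suffices. *)
Lemma dim_limg_eq_ker (f g phi : {linear quat R -> quat R}) :
  bijective phi -> (forall X, (g X == 0) = (f (phi X) == 0)) ->
  \dim (limg (linfun g)) = \dim (limg (linfun f)).
Proof.
move=> [psi phiK psiK] fg.
have phi0 : lker (linfun phi) == 0%VS.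
  by apply/lker0P => X Y; rewrite !lfunE; apply: can_inj phiK X Y.
suff ker : (linfun phi @: lker (linfun g))%VS = lker (linfun f).
  have := limg_ker_dim (linfun f) fullv; have := limg_ker_dim (linfun g) fullv.
  rewrite !capfv -ker (limg_dim_eq (f := linfun phi)); last by rewrite (eqP phi0) capv0.
  by move=> <- /addnI.
apply/vspaceP => Y; apply/memv_imgP/idP => [[X + ->]|].
  by rewrite !memv_ker !lfunE /= fg.
rewrite memv_ker lfunE /= -{1}[Y]psiK -fg => gX.
by exists (psi Y); rewrite ?memv_ker lfunE ?psiK.
Qed.

(** When t x - p t = t e t, the elements x - e t and p + t e are t^-1 p t and
    t x t^-1, so x and p exchange their roles up to conjugation by t. *)
Lemma sylvester_shift p x e t X : t != 0 -> sylvester p x t = t * e * t ->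
  sylvester (p + t * e) (x - e * t) X = t * sylvester x p (t^-1 * X * t^-1) * t.
Proof.
move=> t0 /eqP; have tU : t \is a GRing.unit by [].
rewrite /sylvester subr_eq addrC => /eqP txE.
have e1 : t * (x - e * t) = p * t by rewrite mulrBr txE mulrA addrK.
have e2 : (p + t * e) * t = t * x by rewrite mulrDl txE.
rewrite -[x - e * t](mulKr tU) e1 -[p + t * e](mulrK tU) e2.
rewrite mulrBr mulrBl !mulrA divrr // mul1r.
by rewrite -!mulrA mulVr // mulr1.
Qed.

Lemma rank_sylvester_lt4 p x : \dim (limg (linfun (sylvester p x))) != 4%N ->
  exists2 Y, Y != 0 & Y * x = p * Y.
Proof.
move=> r4; have := limg_ker_dim (linfun (sylvester p x)) fullv.
rewrite dimvf capfv => dimE.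
have : lker (linfun (sylvester p x)) != 0%VS.
  by apply: contraNneq r4 => k0; rewrite -[X in _ == X]dimE k0 dimv0.
set K := lker _ => K0; exists (vpick K); first by rewrite vpick0.
by have := memv_pick K; rewrite memv_ker lfunE /= subr_eq0 => /eqP.
Qed.

(** The change of variable that carries the kernel of the Sylvester operator at
    another zero l + t^-1 to the kernel at the zero l. *)
Definition twist t (X : quat R) : quat R := qconj (t * X * t).

Lemma twist_is_linear t : linear (twist t).
Proof.
by move=> k X Y; rewrite /twist mulrDr mulrDl -scalerAr -scalerAl linearP.
Qed.
HB.instance Definition _ t := GRing.isLinear.Build R (quat R) (quat R) _
  (twist t) (twist_is_linear t).

Lemma twist_bij t : t != 0 -> bijective (twist t).
Proof.
move=> t0; have tU : t \is a GRing.unit by [].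
exists (fun Y => t^-1 * qconj Y * t^-1) => X; rewrite /twist.
  by rewrite qconjK -mulrA mulrK // mulKr.
by rewrite !mulrA divrr // mul1r -mulrA mulVr // mulr1 qconjK.
Qed.

End Rank.

(** * Zeros of mu other than a given one *)

Section OtherZeros.
Context {R : realType}.
Implicit Types (a b c d l t w V : quat R).

(** Inverting the increment t turns the quadratic equation into a linear one. *)
Lemma mu_shift_eq0 a b c d l t : mu a b c d l = 0 -> t != 0 ->
  mu a b c d (l + t) = 0 <->
  sylvester (b^-1 * (a - l)) (- ((d - l) * b^-1)) t^-1 = - b^-1.
Proof.
move=> l0 t0; have tU : t \is a GRing.unit by [].
rewrite mu_shift l0 add0r sylvester_inv // -opprD -mulrDl -mulrDr.
split=> [/eqP|->]; last by rewrite addNr mulr0 mul0r oppr0.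
by rewrite oppr_eq0 (mulIr_eq0 _ (mulIr tU)) (mulrI_eq0 _ (mulrI tU)) addr_eq0 => /eqP.
Qed.

Lemma infinite_inv_line l w V : V != 0 ->
  infinite_set [set l + (w + k *: V)^-1 | k in [set: R]].
Proof.
move=> V0 fin; apply: infinite_nat; move: fin.
have inj : injective (fun k : R => l + (w + k *: V)^-1).
  move=> k k' /addrI/invr_inj/addrI/eqP.
  by rewrite -subr_eq0 -scalerBl scaler_eq0 (negPf V0) orbF subr_eq0 => /eqP.
rewrite (eq_finite_set (inj_card_eq (in2W inj))) => fin.
apply: sub_finite_set (finite_preimage (f := fun n : nat => n%:R) _ fin) => //.
by apply: in2W; exact/mulrIn/oner_neq0.
Qed.

End OtherZeros.

Theorem proposition30 (R : realType) (a b c d l : quat R) :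
  b != 0 ->
  left_spectrum (mx22 a b c d) l ->
  rank_diff (mu a b c d) l = 2%N ->
  (spherical (mx22 a b c d) /\
   forall l' : quat R, left_spectrum (mx22 a b c d) l' ->
     rank_diff (mu a b c d) l' = 2%N)
  \/ (exists l0 : quat R, left_spectrum (mx22 a b c d) = [set l0]).
Proof.
move=> b0 /(left_spectrumE a b c d l b0) l0 rk2.
have [[t t0 lt0]|uniq] :=
  pselect (exists2 t, t != 0 & mu a b c d (l + t) = 0); last first.
  right; exists l; apply/seteqP; split => [m /(left_spectrumE a b c d m b0) m0|_ ->].
    apply: contrapT => ml; apply: uniq; exists (m - l).
      by rewrite subr_eq0; apply/eqP.
    by rewrite addrC subrK.
  exact/left_spectrumE.
left; move: (rk2); rewrite rank_diff_mu.
have := mu_shift_eq0 _ _ _ _ _ _ l0.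
set x := b^-1 * (a - l); set p := - ((d - l) * b^-1) => eq0 rk.
have [|Y Y0 Yx] := rank_sylvester_lt4 p x; first by rewrite rk.
have xp := qc0_similar Y0 Yx.
split; last first.
  move=> m /(left_spectrumE a b c d m b0).
  have [<- //|ml] := eqVneq l m.
  have : m - l != 0 by rewrite subr_eq0 eq_sym.
  have : m = l + (m - l) by rewrite addrC subrK.
  move: (m - l) => s -> s0 ls0.
  rewrite -rk rank_diff_mu.
  have -> : - ((d - (l + s)) * b^-1) = p + s * b^-1.
    by rewrite opprD addrA mulrBl opprB [LHS]addrC.
  have -> : b^-1 * (a - (l + s)) = x - b^-1 * s.
    by rewrite opprD addrA mulrBr.
  apply: (dim_limg_eq_ker _ _ (twist s^-1)) => [|X].
    by apply: twist_bij; rewrite invr_eq0.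
  have sU : s \is a GRing.unit by [].
  rewrite /= /twist sylvester_conj // sylvester_shift //; last first.
    by move/eqP: ls0; rewrite mu_shift l0 add0r subr_eq0 => /eqP.
  rewrite (mulIr_eq0 _ (mulIr sU)) (mulrI_eq0 _ (mulrI sU)).
  by rewrite -(inj_eq (inv_inj qconjK)) linear0.
(* V spans a direction along which the solution t^-1 can be moved. *)
pose V := qconj Y; have V0 : V != 0.
  by rewrite -(inj_eq (inv_inj qconjK)) qconjK linear0.
have VE : sylvester x p V = 0.
  by rewrite sylvester_conj // /sylvester Yx subrr linear0.
have tE : sylvester x p t^-1 = - b^-1 by apply/eq0.
apply: (sub_infinite_set _ (infinite_inv_line l t^-1 _ V0)) => _ [k _ <-].
have kE : sylvester x p (t^-1 + k *: V) = - b^-1.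
  by rewrite linearD linearZ /= VE scaler0 addr0.
have k0 : t^-1 + k *: V != 0.
  apply: contraNneq b0 => k0; rewrite -invr_eq0 -oppr_eq0 -kE k0.
  by rewrite linear0.
by apply/left_spectrumE => //; apply/eq0; rewrite ?invr_eq0 // invrK.
Qed.
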